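(* Let $A \in \mathbb{C}_{n,m}$ and $D\in \mathbb{C}_{m,n}$. Let $\mathcal{X}$ be any subspace of $\mathbb{C}^n$ such that $\mathbb{C}^n=\mathcal{N}(D)\oplus\mathcal{X}$, and let $\phi:\mathcal{R}(D)\to\mathcal{X}$ be the map $\phi(\mathbf{x})=P_{\mathcal{X},\mathcal{N}(D)}(A\mathbf{x})$ for $\mathbf{x}\in\mathcal{R}(D)$. The following statements are equivalent. (i) $A$ is right invertible along $D$. (ii) $A$ is left invertible along $D$. (iii) $\mathcal{N}(D)=\mathcal{N}(DAD)$. (iv) $\dim \mathcal{N}(D)=\dim \mathcal{N}(DAD)$. (v) $AD\in\mathbb{C}_{n,n}$ is group invertible and $\dim \mathcal{N}(D)=\dim\mathcal{N}(AD)$. (vi) $DA\in \mathbb{C}_{m,m}$ is group invertible and $\mathrm{rk}(DA)=\mathrm{rk}(D)$. (vii) The map $\phi:\mathcal{R}(D) \to \mathcal{X}$ is bijective.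
   Context: $\mathbb{C}_{m,n}$ is the set of $m\times n$ complex matrices ($m,n\in\mathbb{N}$). For a matrix $M\in\mathbb{C}_{p,q}$, $\mathcal{R}(M)=\{M\mathbf{x}:\mathbf{x}\in\mathbb{C}^q\}$ is its column space, $\mathcal{N}(M)=\{\mathbf{x}\in\mathbb{C}^q: M\mathbf{x}=\mathbf{0}\}$ its null space, and $\mathrm{rk}(M)$ its rank. $P_{\mathcal{X},\mathcal{Y}}$ denotes the idempotent (projector) with range $\mathcal{X}$ and null space $\mathcal{Y}$. For $A \in \mathbb{C}_{n,m}$ and $D\in \mathbb{C}_{m,n}$: $A$ is left invertible along $D$ if there exists $C\in\mathbb{C}_{m,n}$ such that $CAD=D$ and $\mathcal{N}(D)\subseteq\mathcal{N}(C)$; $A$ is right invertible along $D$ if there exists $B\in\mathbb{C}_{m,n}$ such that $DAB=D$ and $\mathcal{R}(B)\subseteq\mathcal{R}(D)$. A square matrix $M$ is group invertible if there exists a square matrix $Y$ of the same size with $MYM=M$, $YMY=Y$ and $MY=YM$. *)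

(* Defs.v *)
From HB Require Import structures.
From mathcomp Require Import all_boot all_order all_algebra.

Set Implicit Arguments.
Unset Strict Implicit.
Unset Printing Implicit Defensive.

Import GRing.Theory.
Local Open Scope ring_scope.

(* Matrices act on column vectors by left multiplication, whereas mathcomp's
   kermx and row-space operations on matrices use row vectors; the range and
   null space are therefore taken as subspaces of 'cV[F]_p and 'cV[F]_q. *)

Definition colspace (F : fieldType) (p q : nat) (M : 'M[F]_(p, q)) :
    {vspace 'cV[F]_p} :=
  limg (linfun (fun x : 'cV[F]_q => M *m x)).

Definition nullspace (F : fieldType) (p q : nat) (M : 'M[F]_(p, q)) :
    {vspace 'cV[F]_q} :=
  lker (linfun (fun x : 'cV[F]_q => M *m x)).

Lemma colspaceP (F : fieldType) (p q : nat) (M : 'M[F]_(p, q)) (y : 'cV[F]_p) :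
  reflect (exists x : 'cV[F]_q, y = M *m x) (y \in colspace M).
Proof.
apply: (iffP memv_imgP) => [[x _ ->]|[x ->]]; exists x; rewrite ?memvf //.
  by rewrite (lfunE (mulmx M)).
by rewrite (lfunE (mulmx M)).
Qed.

Lemma mem_nullspace (F : fieldType) (p q : nat) (M : 'M[F]_(p, q))
    (x : 'cV[F]_q) :
  (x \in nullspace M) = (M *m x == 0).
Proof. by rewrite memv_ker (lfunE (mulmx M)). Qed.

Definition left_invertible_along (F : fieldType) (m n : nat)
    (A : 'M[F]_(n, m)) (D : 'M[F]_(m, n)) : Prop :=
  exists C : 'M[F]_(m, n),
    C *m A *m D = D /\ (nullspace D <= nullspace C)%VS.

Definition right_invertible_along (F : fieldType) (m n : nat)
    (A : 'M[F]_(n, m)) (D : 'M[F]_(m, n)) : Prop :=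
  exists B : 'M[F]_(m, n),
    D *m A *m B = D /\ (colspace B <= colspace D)%VS.

Definition group_invertible (F : fieldType) (n : nat) (M : 'M[F]_n) : Prop :=
  exists Y : 'M[F]_n,
    [/\ M *m Y *m M = M, Y *m M *m Y = Y & M *m Y = Y *m M].

Lemma daddv_pi_projector (F : fieldType) (vT : vectType F) (X Y : {vspace vT})
    (P := daddv_pi X Y) :
  (Y + X)%VS = fullv -> directv (Y + X) ->
  [/\ (P \o P)%VF = P, limg P = X & lker P = Y].
Proof.
move=> YXf /directv_addP YX0.
have XY0 : (X :&: Y = 0)%VS by rewrite capvC.
have addP w : P w + daddv_pi Y X w = w.
  by apply: daddv_pi_add => //; rewrite addvC YXf memvf.
split.
- by apply/lfunP => w; rewrite comp_lfunE daddv_pi_proj.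
- apply/vspaceP => w; apply/memv_imgP/idP => [[u _ ->]|wX]; first exact: memv_pi.
  by exists w; rewrite ?memvf // daddv_pi_id.
- apply/vspaceP => w; rewrite memv_ker; apply/eqP/idP => [Pw0|wY].
    by rewrite -[w]addP Pw0 add0r memv_pi.
  by apply: (addIr (daddv_pi Y X w)); rewrite addP add0r daddv_pi_id.
Qed.

Definition phi (F : fieldType) (m n : nat) (A : 'M[F]_(n, m)) (D : 'M[F]_(m, n))
    (X : {vspace 'cV[F]_n}) (x : subvs_of (colspace D)) : subvs_of X :=
  Subvs (memv_pi X (nullspace D) (A *m vsval x)).

Arguments phi {F m n} A D X x.

Lemma val_phi (F : fieldType) (m n : nat) (A : 'M[F]_(n, m)) (D : 'M[F]_(m, n))
    (X : {vspace 'cV[F]_n}) (x : subvs_of (colspace D)) :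
  vsval (phi A D X x) = daddv_pi X (nullspace D) (A *m vsval x).
Proof. by []. Qed.

(* Main.v *)
Require Import Defs.
From HB Require Import structures.
From mathcomp Require Import all_boot all_order all_algebra.
From mathcomp Require Import reals complex.

(** All seven statements say that the inner factor A of D A D loses no rank:
    rk (D A D) = rk D.  Call this condition (R).

    The rows of D A D are combinations of the rows of D, and its columns are
    combinations of the columns of D, so (R) can be read on either side: it
    means D = Z D A D for some Z, and also D = D A D W for some W.  Taking
    C = Z D and B = D W gives the left and the right inverse along D;
    conversely the inclusions of null spaces and of ranges required of C and B
    are exactly what lets one factor D out of them
    ([nullspace_leP], [colspace_leP]).

    The two statements comparing N(D) with N(D A D) are (R) read on null
    spaces, since N(D) is always contained in N(D A D).  As for A D and D A, a
    square matrix M is group invertible exactly when rk (M M) = rk M ([group_invertible_rankP]).  Under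
    (R), iterating D = Z D A D shows that even D A D A D has the rank of D
    ([rank_sandwich2]), which squeezes the ranks of A D A D and D A D A, the
    squares of A D and D A; conversely each of these two squares contains D A D
    as a factor.

    Finally phi (D v) = 0 says that A D v lies in N(D), that is D A D v = 0, so
    phi is injective exactly when N(D A D) is contained in N(D), which is (R).
    Surjectivity then comes for free: if D = D A D W, every x in X differs from
    A D W x by an element of N(D), so phi (D W x) = x. *)

Set Implicit Arguments.
Unset Strict Implicit.
Unset Printing Implicit Defensive.

Import GRing.Theory.
Local Open Scope ring_scope.

(** * Factoring matrices through ranges and null spaces *)

(** Applied to the columns of N, each of which lies in the range of M, the
    right-hand side solves N = M Z one column at a time. *)
Lemma colspace_leP (F : fieldType) (p q r : nat)
    (M : 'M[F]_(p, q)) (N : 'M[F]_(p, r)) :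
  (colspace N <= colspace M)%VS <-> exists Z, N = M *m Z.
Proof.
split=> [/subvP sNM | [Z ->]]; last first.
  by apply/subvP => _ /colspaceP[x ->]; apply/colspaceP; exists (Z *m x);
     rewrite mulmxA.
have /submxP[Z NZ]: (N^T <= M^T)%MS.
  apply/row_subP => j; have /sNM/colspaceP[x Nx]: col j N \in colspace N.
    by apply/colspaceP; exists (delta_mx j 0); rewrite colE.
  by rewrite -tr_col Nx trmx_mul submxMl.
by exists Z^T; rewrite -[N]trmxK NZ trmx_mul trmxK.
Qed.

(** The columns of the cokernel matrix of M lie in the null space of M; if N
    kills them all, then every row of N is a combination of rows of M. *)
Lemma nullspace_leP (F : fieldType) (p q r : nat)
    (M : 'M[F]_(p, q)) (N : 'M[F]_(r, q)) :
  (nullspace M <= nullspace N)%VS = (N <= M)%MS.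
Proof.
apply/idP/idP => [/subvP sMN | /submxP[Z ->]]; last first.
  by apply/subvP => x; rewrite !mem_nullspace -mulmxA => /eqP->; rewrite mulmx0.
rewrite submxE; apply/eqP/trmx_inj/row_matrixP => j.
rewrite -tr_col trmx0 row0 colE -mulmxA; apply/trmx_inj; rewrite trmxK trmx0.
apply/eqP; rewrite -mem_nullspace; apply: sMN.
by rewrite mem_nullspace mulmxA mulmx_coker mul0mx.
Qed.

Lemma rank_le_submx (F : fieldType) (p q r : nat)
    (M : 'M[F]_(p, q)) (N : 'M[F]_(r, q)) :
  (M <= N)%MS -> (\rank N <= \rank M)%N -> (N <= M)%MS.
Proof. by move=> sMN rNM; rewrite -(geq_leqif (mxrank_leqif_sup sMN)). Qed.

Lemma rank_mulr_factor (F : fieldType) (p q r : nat)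
    (M : 'M[F]_(p, q)) (N : 'M[F]_(q, r)) :
  (\rank M <= \rank (M *m N))%N -> exists W, M = M *m N *m W.
Proof.
move=> rM; have /submxP[Z MZ]: (M^T <= (M *m N)^T)%MS.
  by apply: rank_le_submx; rewrite ?mxrank_tr // trmx_mul submxMl.
by exists Z^T; apply: trmx_inj; rewrite [RHS]trmx_mul trmxK.
Qed.

Lemma rank_mull_factor (F : fieldType) (p q r : nat)
    (M : 'M[F]_(p, q)) (N : 'M[F]_(r, p)) :
  (\rank M <= \rank (N *m M))%N -> exists Z, M = Z *m (N *m M).
Proof. by move=> rM; apply/submxP/rank_le_submx => //; apply: submxMl. Qed.

(** * Group invertibility and rank *)

(** If rk (M M) = rk M then M = U M M = M M V, whence U M = U M M V = M V, and
    U M V is the group inverse. *)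
Lemma group_invertible_rankP (F : fieldType) (n : nat) (M : 'M[F]_n) :
  group_invertible M <-> \rank (M *m M) = \rank M.
Proof.
split=> [[Y [MYM _ MY]] | rM].
  apply/eqP; rewrite eqn_leq mxrankM_maxl /=.
  by rewrite -{1}MYM MY -mulmxA mxrankM_maxr.
have [U MU] : exists U, M = U *m (M *m M) by apply: rank_mull_factor; rewrite rM.
have [V MV] : exists V, M = M *m M *m V by apply: rank_mulr_factor; rewrite rM.
have UV : U *m M = M *m V by rewrite {1}MV !mulmxA -(mulmxA U) -MU.
have MY : M *m (U *m M *m V) = M *m V by rewrite UV !mulmxA -MV.
have YM : U *m M *m V *m M = U *m M by rewrite -(mulmxA U) -UV -!mulmxA -MU.
exists (U *m M *m V); split.
- by rewrite MY -UV -mulmxA -MU.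
- by rewrite YM -mulmxA MY mulmxA.
- by rewrite MY YM UV.
Qed.

(** * The rank condition on D A D *)

Section RankCondition.

Variables (F : fieldType) (m n : nat) (A : 'M[F]_(n, m)) (D : 'M[F]_(m, n)).

Local Notation rank_sandwich := (\rank D <= \rank (D *m A *m D))%N.

(** Multiplying D = Z D A D on the right by A D gives D A D = Z D A D A D. *)
Lemma rank_sandwich2 :
  rank_sandwich -> (\rank D <= \rank (D *m A *m D *m A *m D))%N.
Proof.
move=> rD; apply: (leq_trans rD).
have [Z DZ] := rank_mull_factor rD.
by rewrite {1}DZ -!mulmxA mxrankM_maxr.
Qed.

Lemma right_invertible_alongP : right_invertible_along A D <-> rank_sandwich.
Proof.
split=> [[B [DAB /colspace_leP[W BW]]] | rD].
  by rewrite -{1}DAB BW mulmxA mxrankM_maxl.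
have [W DW] : exists W, D = D *m (A *m D) *m W.
  by apply: rank_mulr_factor; rewrite mulmxA.
exists (D *m W); split; first by rewrite {3}DW !mulmxA.
by apply/colspace_leP; exists W.
Qed.

Lemma left_invertible_alongP : left_invertible_along A D <-> rank_sandwich.
Proof.
split=> [[C [CAD]] | rD].
  rewrite nullspace_leP => /submxP[Z CZ].
  by rewrite -{1}CAD CZ -!mulmxA mxrankM_maxr.
have [Z DZ] := rank_mull_factor rD.
exists (Z *m D); split; first by rewrite {3}DZ !mulmxA.
by rewrite nullspace_leP submxMl.
Qed.

(** N(D) is contained in N(B D), so equal dimensions force equality.  Besides
    B = D A, the case B = A is needed for the group invertibility of A D. *)
Lemma dim_nullspace_mull (p : nat) (B : 'M[F]_(p, m)) :
  \dim (nullspace D) = \dim (nullspace (B *m D)) <->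
  nullspace D = nullspace (B *m D).
Proof.
split=> [dD | <- //]; apply/eqP.
by rewrite eqEdim nullspace_leP submxMl dD leqnn.
Qed.

(** The rows of B D are combinations of those of D; both sides say that the
    converse holds too. *)
Lemma nullspace_mullP (p : nat) (B : 'M[F]_(p, m)) :
  nullspace D = nullspace (B *m D) <-> (\rank D <= \rank (B *m D))%N.
Proof.
have sBD : (B *m D <= D)%MS by apply: submxMl.
split=> [ND | rD].
  by apply: mxrankS; rewrite -nullspace_leP ND.
by apply/eqP; rewrite eqEsubv !nullspace_leP sBD rank_le_submx.
Qed.

(** A D A D has D A D as right factor and is a right factor of D A D A D, so
    rk (D A D A D) <= rk (A D A D) <= rk (D A D). *)
Lemma group_invertible_mullP :
  (group_invertible (A *m D) /\
     \dim (nullspace D) = \dim (nullspace (A *m D))) <-> rank_sandwich.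
Proof.
rewrite group_invertible_rankP dim_nullspace_mull nullspace_mullP.
split=> [[rAD rD] | rD].
  by apply: (leq_trans rD); rewrite -rAD -mulmxA [D *m _]mulmxA mxrankM_maxr.
split; last by apply: (leq_trans rD); rewrite -mulmxA mxrankM_maxr.
apply/eqP; rewrite eqn_leq mxrankM_maxl /=.
apply: (leq_trans (mxrankM_maxr _ _)); apply: (leq_trans (rank_sandwich2 rD)).
by rewrite -!mulmxA mxrankM_maxr.
Qed.

(** Mirror image of [group_invertible_mullP]: D A D A has D A D as left factor
    and is a left factor of D A D A D. *)
Lemma group_invertible_mulrP :
  (group_invertible (D *m A) /\ \rank (D *m A) = \rank D) <-> rank_sandwich.
Proof.
rewrite group_invertible_rankP; split=> [[rDA <-] | rD].
  by rewrite -rDA mulmxA mxrankM_maxl.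
split; apply/eqP; rewrite eqn_leq mxrankM_maxl /=; last first.
  by apply: (leq_trans rD); rewrite mxrankM_maxl.
apply: (leq_trans (mxrankM_maxl _ _)); apply: (leq_trans (rank_sandwich2 rD)).
by rewrite !mulmxA mxrankM_maxl.
Qed.

(** * The map phi *)

Variable X : {vspace 'cV[F]_n}.
Hypotheses (hsum : (nullspace D + X)%VS = fullv)
           (hdirect : directv (nullspace D + X)).

(** The projector onto X along N(D) has kernel N(D), as has D; so testing
    equality after projecting amounts to testing it after multiplying by D. *)
Lemma daddv_pi_nullspace_eq (u v : 'cV[F]_n) :
  (daddv_pi X (nullspace D) u == daddv_pi X (nullspace D) v)
  = (D *m u == D *m v).
Proof.
have [_ _ kerP] := daddv_pi_projector hsum hdirect.
by rewrite -subr_eq0 -linearB -memv_ker kerP mem_nullspace mulmxBr subr_eq0.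
Qed.

(** phi (D v) = 0 exactly when D A D v = 0, so a trivial kernel for phi means
    that N(D A D) is contained in N(D). *)
Lemma phi_injP : injective (phi A D X) <-> rank_sandwich.
Proof.
split=> [phi_inj | /nullspace_mullP ND x y /(congr1 vsval)/eqP].
  apply: mxrankS; rewrite -nullspace_leP; apply/subvP => v.
  rewrite !mem_nullspace => DADv.
  have RDv : D *m v \in colspace D by apply/colspaceP; exists v.
  suff /phi_inj/(congr1 vsval)/= -> : phi A D X (Subvs RDv) = phi A D X 0 by [].
  apply/val_inj/eqP; rewrite /= daddv_pi_nullspace_eq.
  by rewrite linear0 !mulmx0 !mulmxA.
rewrite /= daddv_pi_nullspace_eq => /eqP DAxy; apply/val_inj/eqP.
have /colspaceP[v xyv] : vsval (x - y) \in colspace D by apply: subvsP.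
rewrite -subr_eq0 -[_ - _]/(vsval (x - y)) xyv -mem_nullspace ND mem_nullspace.
by rewrite -!mulmxA -xyv linearB /= !mulmxBr DAxy subrr.
Qed.

(** Injectivity already gives (R); then D = D A D W makes x |-> D W x the
    inverse of phi. *)
Lemma phi_bijP : bijective (phi A D X) <-> rank_sandwich.
Proof.
split=> [/bij_inj/phi_injP // | rD].
have [W DW] : exists W, D = D *m (A *m D) *m W.
  by apply: rank_mulr_factor; rewrite mulmxA.
have RDW (x : 'cV[F]_n) : D *m (W *m x) \in colspace D.
  by apply/colspaceP; exists (W *m x).
pose psi (x : subvs_of X) := Subvs (RDW (vsval x)).
have psiK : cancel psi (phi A D X).
  move=> x; apply: val_inj => /=.
  have XN0 : (X :&: nullspace D = 0)%VS.
    by rewrite capvC; apply/directv_addP.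
  rewrite -[RHS](daddv_pi_id XN0 (subvsP x)); apply/eqP.
  by rewrite daddv_pi_nullspace_eq {3}DW !mulmxA.
by exists psi => //; apply: inj_can_sym psiK _; apply/phi_injP.
Qed.

End RankCondition.

Theorem theorem3p7 (R : realType) (m n : nat)
    (A : 'M[R[i]]_(n, m)) (D : 'M[R[i]]_(m, n)) (X : {vspace 'cV[R[i]]_n})
    (hsum : (nullspace D + X)%VS = fullv)
    (hdirect : directv (nullspace D + X)) :
  [<-> right_invertible_along A D;
       left_invertible_along A D;
       nullspace D = nullspace (D *m A *m D);
       \dim (nullspace D) = \dim (nullspace (D *m A *m D));
       group_invertible (A *m D) /\
         \dim (nullspace D) = \dim (nullspace (A *m D));
       group_invertible (D *m A) /\ \rank (D *m A) = \rank D;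
       bijective (phi A D X)].
Proof.
tfae.
- by move/right_invertible_alongP/left_invertible_alongP.
- by move/left_invertible_alongP/nullspace_mullP.
- by move/dim_nullspace_mull.
- by move/dim_nullspace_mull/nullspace_mullP/group_invertible_mullP.
- by move/group_invertible_mullP/group_invertible_mulrP.
- by move/group_invertible_mulrP/(phi_bijP A hsum hdirect).
- by move/(phi_bijP A hsum hdirect)/right_invertible_alongP.
Qed.
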